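(* Let $\mathcal{M}$ be a unitary magma. The partial composition of $\mathsf{C}\mathcal{M}$ is expressed over the $\mathsf{H}$-basis, for any $\mathcal{M}$-cliques $\mathfrak{p}$ and $\mathfrak{q}$ both different from the unique $\mathcal{M}$-clique of arity $1$ and any $i\in\{1,\dots,|\mathfrak{p}|\}$, as $$\mathsf{H}_{\mathfrak{p}}\circ_i\mathsf{H}_{\mathfrak{q}}=\begin{cases}\mathsf{H}_{\mathfrak{p}\circ_i\mathfrak{q}}+\mathsf{H}_{\mathrm{d}_i(\mathfrak{p})\circ_i\mathfrak{q}}+\mathsf{H}_{\mathfrak{p}\circ_i\mathrm{d}_0(\mathfrak{q})}+\mathsf{H}_{\mathrm{d}_i(\mathfrak{p})\circ_i\mathrm{d}_0(\mathfrak{q})}&\text{if }\mathfrak{p}_i\ne\mathds{1}_{\mathcal{M}}\text{ and }\mathfrak{q}_0\ne\mathds{1}_{\mathcal{M}},\\ \mathsf{H}_{\mathfrak{p}\circ_i\mathfrak{q}}+\mathsf{H}_{\mathrm{d}_i(\mathfrak{p})\circ_i\mathfrak{q}}&\text{if }\mathfrak{p}_i\ne\mathds{1}_{\mathcal{M}}\text{ and }\mathfrak{q}_0=\mathds{1}_{\mathcal{M}},\\ \mathsf{H}_{\mathfrak{p}\circ_i\mathfrak{q}}+\mathsf{H}_{\mathfrak{p}\circ_i\mathrm{d}_0(\mathfrak{q})}&\text{if }\mathfrak{p}_i=\mathds{1}_{\mathcal{M}}\text{ and }\mathfrak{q}_0\ne\mathds{1}_{\mathcal{M}},\\ \mathsf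{H}_{\mathfrak{p}\circ_i\mathfrak{q}}&\text{otherwise.}\end{cases}$$
   Context: All vector spaces are over a field $\mathbb{K}$ of characteristic zero; $[n]=\{1,\dots,n\}$. A unitary magma is a set $\mathcal{M}$ with a binary operation $\star$ (not necessarily associative) having a two-sided unit $\mathds{1}_{\mathcal{M}}$. An $\mathcal{M}$-clique $\mathfrak{p}$ of arity $|\mathfrak{p}|=n\ge1$ is a map assigning to every arc $(x,y)$, $1\le x<y\le n+1$, a label $\mathfrak{p}(x,y)\in\mathcal{M}$; by convention, the only $\mathcal{M}$-clique of arity $1$ is the one with $\mathfrak{p}(1,2)=\mathds{1}_{\mathcal{M}}$. The base is the arc $(1,n+1)$; for $n\ge2$ the $i$th edge is $(i,i+1)$, $i\in[n]$; the other arcs are the diagonals. Put $\mathfrak{p}_0:=\mathfrak{p}(1,n+1)$ and $\mathfrak{p}_i:=\mathfrak{p}(i,i+1)$ for $i\in[n]$. $\mathsf{C}\mathcal{M}$ is the (nonsymmetric) operad whose space $\mathsf{C}\mathcal{M}(n)$ is the linear span of all $\mathcal{M}$-cliques of arity $n$, whose unit is the unique $\mathcal{M}$-clique of arity $1$, and where, for $\mathcal{M}$-cliques $\mathfrak{p},\mathfrak{q}$ of arities $n,m$ and $i\in[n]$, $\mathfrak{p}\circ_i\mathfrak{q}$ is the $\mathcal{M}$-clique of arity $n+m-1$ with $$(\mathfrak{p}\circ_i\mathfrak{q})(x,y)=\begin{cases}\mathfrak{p}(x,y)&\text{if }y\le i,\\ \mathfrak{p}(x,y-m+1)&\text{if }x\le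 i<i+m\le y,\ (x,y)\ne(i,i+m),\\ \mathfrak{p}(x-m+1,y-m+1)&\text{if }i+m\le x,\\ \mathfrak{q}(x-i+1,y-i+1)&\text{if }i\le x<y\le i+m,\ (x,y)\ne(i,i+m),\\ \mathfrak{p}_i\star\mathfrak{q}_0&\text{if }(x,y)=(i,i+m),\\ \mathds{1}_{\mathcal{M}}&\text{otherwise.}\end{cases}$$ For $\mathcal{M}$-cliques of the same arity, write $\mathfrak{p}'\preceq_{\mathrm{be}}\mathfrak{p}$ if $\mathfrak{p}$ can be obtained from $\mathfrak{p}'$ by replacing some labels $\mathds{1}_{\mathcal{M}}$ of its edges or its base by other labels of $\mathcal{M}$. Set $\mathsf{H}_{\mathfrak{p}}:=\sum_{\mathfrak{p}'\preceq_{\mathrm{be}}\mathfrak{p}}\mathfrak{p}'$; the family of all $\mathsf{H}_{\mathfrak{p}}$ is a basis of $\mathsf{C}\mathcal{M}$, called the $\mathsf{H}$-basis. $\mathrm{d}_0(\mathfrak{p})$ (resp. $\mathrm{d}_i(\mathfrak{p})$, $i\ge 1$) denotes the $\mathcal{M}$-clique obtained by replacing the label of the base (resp. of the $i$th edge) of $\mathfrak{p}$ by $\mathds{1}_{\mathcal{M}}$. *)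

(* Defs.v *)
From HB Require Import structures.
From mathcomp Require Import all_boot all_order all_algebra.
From mathcomp Require Import finmap monalg.
From mathcomp Require Import boolp classical_sets cardinality fsbigop.

Set Implicit Arguments.
Unset Strict Implicit.
Unset Printing Implicit Defensive.

Import GRing.Theory.

Local Open Scope ring_scope.

(* Points are numbered from 0: the polygon of arity n has the points 0 to n,
   so the arc (x, y) of the usual 1-based convention is (x - 1, y - 1) here. *)
Definition clique_arc (n : nat) : predArgType :=
  {a : 'I_n.+1 * 'I_n.+1 | (a.1 < a.2)%N}.

Definition src n (a : clique_arc n) : nat := (val a).1.
Definition tgt n (a : clique_arc n) : nat := (val a).2.

Definition is_base n (a : clique_arc n) : bool := (src a == 0%N) && (tgt a == n).
(* In arity 1 the only arc is the base, and there are no edges. *)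
Definition is_edge n (a : clique_arc n) : bool :=
  (1 < n)%N && (tgt a == (src a).+1).

(* Arities are meant to be positive, which the operations below enforce by
   taking cliques of arity n.+1. *)
Record clique (M : umagmaType) (n : nat) : predArgType := Clique {
  clique_fun :> {ffun clique_arc n -> M};
  clique_arity1 : (n == 1)%N ==> [forall a, clique_fun a == 1%g] }.

HB.instance Definition _ (M : umagmaType) n := [isSub for @clique_fun M n].
HB.instance Definition _ (M : umagmaType) n := [Choice of clique M n by <:].

Section Cliques.
Variable M : umagmaType.

(* The value 1 returned when (x, y) is not an arc is a dummy one: label is only
   evaluated at arcs. *)
Definition label n (p : clique M n) (x y : nat) : M :=
  if [pick a : clique_arc n | (src a == x) && (tgt a == y)] is Some a
  then p a else 1%g.

Definition base_label n (p : clique M n) : M := label p 0 n.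

(* The edge usually numbered i + 1. *)
Definition edge_label n (p : clique M n) (i : 'I_n) : M := label p i i.+1.

Lemma label1 (p : clique M 1) x y : label p x y = 1%g.
Proof.
rewrite /label; case: pickP => // a _.
by have /forallP/(_ a)/eqP := clique_arity1 p.
Qed.

Lemma unit_clique_subproof :
  (1 == 1)%N ==> [forall a, [ffun _ : clique_arc 1 => 1%g : M] a == 1%g].
Proof. by apply/forallP => a; rewrite ffunE. Qed.

Definition unit_clique : clique M 1 := Clique unit_clique_subproof.

(* With |p| = n + 1 and |q| = m + 1 the composite has arity n + m + 1, and the
   shift |q| - 1 is m. *)
Definition comp_label n m (p : clique M n.+1) (i : 'I_n.+1)
    (q : clique M m.+1) (x y : nat) : M :=
  if (y <= i)%N then label p x y
  else if [&& x <= i, i + m.+1 <= y & (x, y) != (i : nat, i + m.+1)]%N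
    then label p x (y - m)
  else if (i + m.+1 <= x)%N then label p (x - m) (y - m)
  else if [&& i <= x, y <= i + m.+1 & (x, y) != (i : nat, i + m.+1)]%N
    then label q (x - i) (y - i)
  else if (x, y) == (i : nat, i + m.+1)%N
    then (edge_label p i * base_label q)%g
  else 1%g.

Lemma comp_clique_subproof n m (p : clique M n.+1) (i : 'I_n.+1)
    (q : clique M m.+1) (f := [ffun a : clique_arc (n + m).+1 =>
      comp_label p i q (src a) (tgt a)]) :
  ((n + m).+1 == 1)%N ==> [forall a, f a == 1%g].
Proof.
apply/implyP; rewrite eqSS addn_eq0 => /andP[/eqP n0 /eqP m0].
subst n m; apply/forallP => a; rewrite {}/f ffunE /comp_label.
by rewrite /edge_label /base_label !label1 mulg1 !if_same.
Qed.

Definition comp_clique n m (p : clique M n.+1) (i : 'I_n.+1)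
    (q : clique M m.+1) : clique M (n + m).+1 :=
  Clique (comp_clique_subproof p i q).

Lemma erase_subproof n (p : clique M n) (x y : nat) (f := [ffun a : clique_arc n =>
    if (src a == x) && (tgt a == y) then 1%g else p a]) :
  (n == 1)%N ==> [forall a, f a == 1%g].
Proof.
apply/implyP => n1; apply/forallP => a; rewrite ffunE; case: ifP => // _.
by have /implyP/(_ n1)/forallP := clique_arity1 p.
Qed.

Definition erase n (p : clique M n) (x y : nat) : clique M n :=
  Clique (erase_subproof p x y).

Definition d_base n (p : clique M n) : clique M n := erase p 0 n.
Definition d_edge n (p : clique M n) (i : 'I_n) : clique M n := erase p i i.+1.

Definition le_be n (p' p : clique M n) : bool :=
  [forall a : clique_arc n,
    (p' a == p a) || (is_edge a || is_base a) && (p' a == 1%g)].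

End Cliques.

(* The space spanned by the cliques of arity n, with basis the << p >>. *)
Notation CM K M n := {malg K[clique M n]}.

Section Operad.
Variables (K : fieldType) (M : umagmaType).

Definition partial_comp n m (u : CM K M n.+1) (i : 'I_n.+1) (v : CM K M m.+1) :
    CM K M (n + m).+1 :=
  \sum_(p <- msupp u) \sum_(q <- msupp v)
    (u@_p * v@_q) *: << comp_clique p i q >>.

(* A clique has finitely many minorants, even if M is infinite, so that the
   finitely supported sum defining Hbasis is the expected one. *)
Lemma finite_le_be n (p : clique M n) : finite_set [set p' | le_be p' p].
Proof.
pose r (s : {set clique_arc n}) : {ffun clique_arc n -> M} :=
  [ffun a => if a \in s then 1%g else p a].
suff sub : ([set p' | le_be p' p] `<=`
    [set` [seq odflt p (insub (r s)) | s : {set clique_arc n}]])%classic.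
  exact: sub_finite_set sub (finite_seq _).
move=> p' /= /forallP le_p; apply/mapP.
exists [set a | p' a == 1%g & p a != 1%g]%SET; first by rewrite mem_enum.
suff -> : r [set a | p' a == 1%g & p a != 1%g]%SET = val p' by rewrite valK.
apply/ffunP => a; rewrite ffunE inE.
have /orP[/eqP->|/andP[_ /eqP->]] := le_p a; first by rewrite andbN.
by rewrite eqxx; case: eqP.
Qed.

Definition Hbasis n (p : clique M n) : CM K M n :=
  \sum_(p' \in [set p' | le_be p' p]%classic) (<< p' >> : CM K M n).

End Operad.

Arguments Hbasis K {M n} p.

(* Main.v *)
Require Import Defs.
From mathcomp Require Import all_boot all_order all_algebra.
From mathcomp Require Import finmap monalg.
From mathcomp Require Import boolp classical_sets cardinality fsbigop.
From mathcomp Require Import zify.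

Import GRing.Theory.
Local Open Scope ring_scope.

(** For cliques [p] and [q] of arity at least 2, the product of [Hbasis p] and
    [Hbasis q] is the sum of the composites of [p'] and [q'] over all minorants
    [p'] of [p] and [q'] of [q].  The composition glues the edge [i] of [p] to
    the base of [q]; as both arities are at least 2, the resulting arc is a
    diagonal of the composite, while the other edges and bases of [p] and [q]
    remain boundary arcs and the diagonals remain diagonals.  So, if the
    labels of [p'] and [q'] on the two glued arcs are those of [p] and [q], the
    composite of [p'] and [q'] is a minorant of that of [p] and [q], and each
    such minorant arises exactly once: restricting it to the two sub-polygons
    recovers [p'] and [q'] ([sum_comp_minorants_fixing]).

    On a boundary arc where [p] has a label other than 1, a minorant of [p]
    has either the same label as [p] or the label 1; in the latter case it is a
    minorant of the clique obtained from [p] by erasing that arc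
    ([sum_minorants_split]).  Splitting the sum over [p'] along the edge [i] and
    the sum over [q'] along the base gives one term for each choice of keeping
    or erasing a nontrivial label, which are the terms of the formula. *)

(** * Cliques as functions on pairs of naturals *)

Section Labels.
Set Implicit Arguments.
Unset Strict Implicit.
Variable M : umagmaType.

Lemma label_src_tgt n (p : clique M n) a : label p (src a) (tgt a) = p a.
Proof.
rewrite /label; case: pickP => [b /andP[/eqP sE /eqP tE]|/(_ a)].
  congr (p _); apply/val_inj; case: b a sE tE => [[b1 b2] hb] [[a1 a2] ha].
  by rewrite /src /tgt /= => sE tE; congr (_, _); apply/val_inj.
by rewrite !eqxx.
Qed.

Lemma exists_arc n x y : (x < y <= n)%N ->
  exists a : clique_arc n, src a = x /\ tgt a = y.
Proof.
move=> /andP[xy yn].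
have xn : (x < n.+1)%N by lia.
by exists (@exist _ (fun a : 'I_n.+1 * 'I_n.+1 => (a.1 < a.2)%N)
  (Ordinal xn, Ordinal (yn : (y < n.+1)%N)) xy).
Qed.

Lemma arc_bounds n (a : clique_arc n) : (src a < tgt a <= n)%N.
Proof. by rewrite (valP a) /= -ltnS; exact: ltn_ord. Qed.

Lemma clique_ext n (p q : clique M n) :
  (forall x y, (x < y <= n)%N -> label p x y = label q x y) -> p = q.
Proof.
move=> eq_pq; apply/val_inj/ffunP => a.
have := eq_pq _ _ (arc_bounds a); rewrite !label_src_tgt; exact.
Qed.

(** Constant 1 in arity 1, so that no side condition on [n] or [f] is needed to
    form the clique. *)
Lemma clique_of_subproof n (f : nat -> nat -> M) :
  (n == 1)%N ==> [forall a : clique_arc n,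
    [ffun a : clique_arc n =>
      if n == 1%N then 1%g else f (src a) (tgt a)] a == 1%g].
Proof. by apply/implyP => n1; apply/forallP => a; rewrite ffunE n1. Qed.

Definition clique_of n (f : nat -> nat -> M) : clique M n :=
  Clique (clique_of_subproof n f).

Lemma label_clique_of n f x y : n != 1%N -> (x < y <= n)%N ->
  label (clique_of n f) x y = f x y.
Proof.
move=> n1 /exists_arc[a [<- <-]].
by rewrite label_src_tgt ffunE (negPf n1).
Qed.

Lemma label_comp n m (p : clique M n.+1) i (q : clique M m.+1) x y :
  (x < y <= (n + m).+1)%N ->
  label (comp_clique p i q) x y = comp_label p i q x y.
Proof. by move=> /exists_arc[a [<- <-]]; rewrite label_src_tgt ffunE. Qed.

Lemma label_erase n (p : clique M n) u v x y : (x < y <= n)%N ->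
  label (erase p u v) x y = if (x == u) && (y == v) then 1%g else label p x y.
Proof. by move=> /exists_arc[a [<- <-]]; rewrite !label_src_tgt ffunE. Qed.

Definition boundary n x y : bool :=
  (1 < n)%N && (y == x.+1) || (x == 0%N) && (y == n).

Lemma le_beP n (p' p : clique M n) :
  reflect (forall x y, (x < y <= n)%N -> label p' x y = label p x y \/
             boundary n x y /\ label p' x y = 1%g)
          (le_be p' p).
Proof.
apply: (iffP forallP) => [le_p x y /exists_arc[a [<- <-]]|le_p a].
  by rewrite !label_src_tgt; have /orP[/eqP|/andP[ba /eqP]] := le_p a;
    [left | right].
have := le_p _ _ (arc_bounds a); rewrite !label_src_tgt.
by case=> [->|[ba ->]]; apply/orP; [left | right; rewrite eqxx andbT].
Qed.

Lemma clique_arity_gt1 n (p : clique M n.+1) :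
  Tagged (clique M) p <> Tagged (clique M) (unit_clique M) -> (0 < n)%N.
Proof.
case: n p => // p; case.
congr (Tagged (clique M) _); apply: clique_ext => x y _.
by rewrite !label1.
Qed.

(** * The composite seen from the two sub-polygons *)

Section Glue.
Variables (n m : nat) (i : 'I_n.+1).

(** Where the vertex [z] of the first clique lies in the composite. *)
Definition outer_pt z := if (z <= i)%N then z else (z + m)%N.

(** The coordinates of an arc of the composite in the sub-polygon to which it
    belongs.  The glued arc, common to both, is a case of its own, and an arc
    which crosses it carries the label 1 in every composite. *)
Variant arc_position : nat -> nat -> Prop :=
| Glued : arc_position i (i + m.+1)%N
| Outer x y of (x < y <= n.+1)%N & (x, y) != (i : nat, i.+1) :
    arc_position (outer_pt x) (outer_pt y)
| Inner x y of (x < y <= m.+1)%N & (x, y) != (0, m.+1)%N :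
    arc_position (x + i)%N (y + i)%N
| Crossing x y of (forall (p : clique M n.+1) (q : clique M m.+1),
                     comp_label p i q x y = 1%g) : arc_position x y.

Lemma arcP x y : (x < y <= (n + m).+1)%N -> arc_position x y.
Proof.
move=> xy; have i_lt := ltn_ord i.
case: (boolP ((x, y) == (i : nat, i + m.+1)%N)) => [/eqP[-> ->]|xy_ng].
  exact: Glued.
case: (boolP [|| y <= i, (x <= i) && (i + m.+1 <= y) | i + m.+1 <= x]%N) => out.
  pose back z := if (z <= i)%N then z else (z - m)%N.
  have -> : x = outer_pt (back x).
    by rewrite /outer_pt /back; do ![case: ifP]; lia.
  have -> : y = outer_pt (back y).
    by rewrite /outer_pt /back; do ![case: ifP]; lia.
  by apply: Outer; move: xy_ng; rewrite /back ?xpair_eqE; do ![case: ifP]; lia.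
case: (boolP ((i <= x) && (y <= i + m.+1))%N) => inn.
  have -> : x = (x - i + i)%N by lia.
  have -> : y = (y - i + i)%N by lia.
  by apply: Inner; move: xy_ng; rewrite ?xpair_eqE; lia.
apply: Crossing => p q; rewrite /comp_label !xpair_eqE in xy_ng *.
by do ![case: ifP => //]; lia.
Qed.

Lemma comp_label_glued (p : clique M n.+1) (q : clique M m.+1) :
  comp_label p i q i (i + m.+1)%N = (edge_label p i * base_label q)%g.
Proof. by rewrite /comp_label eqxx !andbF; do 2![case: ifP; first by lia]. Qed.

Lemma comp_label_outer (p : clique M n.+1) (q : clique M m.+1) x y :
  (x < y)%N -> (x, y) != (i : nat, i.+1) ->
  comp_label p i q (outer_pt x) (outer_pt y) = label p x y.
Proof.
rewrite /comp_label /outer_pt !xpair_eqE => xy ng.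
case: (leqP x i) => xi; case: (leqP y i) => yi; rewrite ?yi ?addnK //.
- by rewrite ifF ?ifT //; lia.
- by lia.
- by do 2![rewrite ifF; last by lia]; rewrite ifT //; lia.
Qed.

Lemma comp_label_inner (p : clique M n.+1) (q : clique M m.+1) x y :
  (x < y <= m.+1)%N -> (x, y) != (0, m.+1)%N ->
  comp_label p i q (x + i)%N (y + i)%N = label q x y.
Proof.
rewrite /comp_label !xpair_eqE => xy ng.
by do 3![rewrite ifF; last by lia]; rewrite ifT ?addnK //; lia.
Qed.

Lemma outer_pt_bounds x y : (x < y <= n.+1)%N ->
  (outer_pt x < outer_pt y <= (n + m).+1)%N.
Proof. by rewrite /outer_pt; have := ltn_ord i; do ![case: ifP]; lia. Qed.

Lemma inner_pt_bounds x y : (x < y <= m.+1)%N ->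
  (x + i < y + i <= (n + m).+1)%N.
Proof. by have := ltn_ord i; lia. Qed.

Hypotheses (n_gt0 : (0 < n)%N) (m_gt0 : (0 < m)%N).

(** This is where both arities must be at least 2: otherwise the glued arc would
    be an edge or the base of the composite. *)
Lemma boundary_glued : boundary (n + m).+1%N i (i + m.+1)%N = false.
Proof. by rewrite /boundary; lia. Qed.

Lemma boundary_outer x y : (x < y)%N -> (x, y) != (i : nat, i.+1) ->
  boundary (n + m).+1%N (outer_pt x) (outer_pt y) = boundary n.+1 x y.
Proof.
rewrite /boundary /outer_pt xpair_eqE; have := ltn_ord i.
by do ![case: ifP]; lia.
Qed.

Lemma boundary_inner x y : (x < y <= m.+1)%N -> (x, y) != (0, m.+1)%N ->
  boundary (n + m).+1%N (x + i)%N (y + i)%N = boundary m.+1 x y.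
Proof. by rewrite /boundary xpair_eqE; have := ltn_ord i; lia. Qed.

(** Restriction to the polygon of the first factor, [c] being the label on the
    edge [i], which the composite does not determine.  Likewise for
    [inner_part] and the base of the second factor. *)
Definition outer_part (c : M) (r : clique M (n + m).+1) : clique M n.+1 :=
  clique_of n.+1 (fun x y =>
    if (x, y) == (i : nat, i.+1) then c else label r (outer_pt x) (outer_pt y)).

Definition inner_part (c : M) (r : clique M (n + m).+1) : clique M m.+1 :=
  clique_of m.+1 (fun x y =>
    if (x, y) == (0, m.+1)%N then c else label r (x + i)%N (y + i)%N).

Lemma label_outer_part c r x y : (x < y <= n.+1)%N ->
  label (outer_part c r) x y =
  if (x, y) == (i : nat, i.+1) then c else label r (outer_pt x) (outer_pt y).
Proof. by move=> xy; rewrite label_clique_of //; lia. Qed.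

Lemma label_inner_part c r x y : (x < y <= m.+1)%N ->
  label (inner_part c r) x y =
  if (x, y) == (0, m.+1)%N then c else label r (x + i)%N (y + i)%N.
Proof. by move=> xy; rewrite label_clique_of //; lia. Qed.

Lemma edge_label_outer_part c r : edge_label (outer_part c r) i = c.
Proof.
by rewrite /edge_label label_outer_part ?eqxx //; have := ltn_ord i; lia.
Qed.

Lemma base_label_inner_part c r : base_label (inner_part c r) = c.
Proof. by rewrite /base_label label_inner_part ?eqxx ?leqnn. Qed.

Lemma outer_part_comp (p : clique M n.+1) (q : clique M m.+1) :
  outer_part (edge_label p i) (comp_clique p i q) = p.
Proof.
apply: clique_ext => x y xy; rewrite label_outer_part //.
case: eqP => [[-> ->]//|/eqP ng].
by rewrite label_comp ?outer_pt_bounds // comp_label_outer //; lia.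
Qed.

Lemma inner_part_comp (p : clique M n.+1) (q : clique M m.+1) :
  inner_part (base_label q) (comp_clique p i q) = q.
Proof.
apply: clique_ext => x y xy; rewrite label_inner_part //.
case: eqP => [[-> ->]//|/eqP ng].
by rewrite label_comp ?inner_pt_bounds // comp_label_inner.
Qed.

Section Minorants.
Variables (p : clique M n.+1) (q : clique M m.+1).

(** The labels on the glued arcs have to agree because the glued arc is a
    diagonal of the composite, on which a minorant cannot change the label. *)
Lemma le_be_comp p' q' : le_be p' p -> edge_label p' i = edge_label p i ->
  le_be q' q -> base_label q' = base_label q ->
  le_be (comp_clique p' i q') (comp_clique p i q).
Proof.
move=> /le_beP le_p p'i /le_beP le_q q'0; apply/le_beP => x y xy.
rewrite !label_comp //; case: (arcP xy) => {x y xy}.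
- by left; rewrite !comp_label_glued p'i q'0.
- move=> x y xy ng; rewrite !comp_label_outer ?boundary_outer; try lia.
  exact: le_p.
- move=> x y xy ng; rewrite !comp_label_inner ?boundary_inner //.
  exact: le_q.
- by move=> x y comp1; left; rewrite !comp1.
Qed.

Variable r : clique M (n + m).+1.
Hypothesis le_r : le_be r (comp_clique p i q).

Lemma le_be_outer_part : le_be (outer_part (edge_label p i) r) p.
Proof.
apply/le_beP => x y xy; rewrite label_outer_part //.
case: eqP => [[-> ->]|/eqP ng]; first by left.
have := le_beP _ _ le_r _ _ (outer_pt_bounds xy).
rewrite label_comp ?outer_pt_bounds // comp_label_outer //; last by lia.
by rewrite boundary_outer //; lia.
Qed.

Lemma le_be_inner_part : le_be (inner_part (base_label q) r) q.
Proof.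
apply/le_beP => x y xy; rewrite label_inner_part //.
case: eqP => [[-> ->]|/eqP ng]; first by left.
have := le_beP _ _ le_r _ _ (inner_pt_bounds xy).
by rewrite label_comp ?inner_pt_bounds // comp_label_inner // boundary_inner.
Qed.

(** A minorant of a composite is determined outside the two sub-polygons and on
    the glued arc: this arc is a diagonal, as both arities are at least 2. *)
Lemma comp_outer_inner_part :
  comp_clique (outer_part (edge_label p i) r) i
              (inner_part (base_label q) r) = r.
Proof.
apply: clique_ext => x y xy; rewrite label_comp //.
have := le_beP _ _ le_r _ _ xy; rewrite label_comp //.
case: (arcP xy) => {x y xy}.
- rewrite boundary_glued !comp_label_glued => -[->|[]//].
  by rewrite edge_label_outer_part base_label_inner_part.
- move=> x y xy ng _; rewrite comp_label_outer //; last by lia.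
  by rewrite label_outer_part // (negPf ng).
- move=> x y xy ng _; rewrite comp_label_inner //.
  by rewrite label_inner_part // (negPf ng).
- by move=> x y comp1; rewrite !comp1 => -[|[_]] ->.
Qed.

End Minorants.
End Glue.
End Labels.

(** * Sums over minorants *)

Section Sums.
Set Implicit Arguments.
Unset Strict Implicit.
Variables (K : fieldType) (M : umagmaType).

Definition minorants n (p : clique M n) : {fset clique M n} :=
  fset_set [set p' | le_be p' p]%classic.

Lemma mem_minorants n (p p' : clique M n) : (p' \in minorants p) = le_be p' p.
Proof. by rewrite in_fset_set ?inE ?mem_setE //; exact: finite_le_be. Qed.

Lemma HbasisE n (p : clique M n) :
  Hbasis K p = \sum_(p' <- minorants p) << p' >>.
Proof. by rewrite /Hbasis fsbig_finite //=; exact: finite_le_be. Qed.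

Lemma mcoeff_Hbasis n (p p' : clique M n) :
  (Hbasis K p)@_p' = (le_be p' p)%:R.
Proof.
rewrite HbasisE raddf_sum /= -mem_minorants.
under eq_bigr => x _ do rewrite mcoeffU.
have [p'_in|p'_out] := boolP (p' \in _).
  rewrite (big_fsetD1 _ p'_in) /= eqxx big_seq big1 ?addr0 // => x.
  by rewrite !inE => /andP[/negPf->].
by rewrite big_seq big1 // => x x_in; case: eqP p'_out => // <-; rewrite x_in.
Qed.

Lemma msupp_Hbasis n (p : clique M n) : msupp (Hbasis K p) = minorants p.
Proof.
apply/fsetP => x; rewrite -mcoeff_neq0 mcoeff_Hbasis mem_minorants.
by case: le_be; rewrite ?oner_neq0 ?eqxx.
Qed.

(** All coefficients of [Hbasis K p] are 0 or 1, since a minorant occurs once in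
    the defining sum; so the bilinear extension of the composition is a plain
    double sum. *)
Lemma partial_comp_Hbasis n m (p : clique M n.+1) i (q : clique M m.+1) :
  partial_comp (Hbasis K p) i (Hbasis K q) =
  \sum_(p' <- minorants p) \sum_(q' <- minorants q) << comp_clique p' i q' >>.
Proof.
rewrite /partial_comp !msupp_Hbasis big_seq [RHS]big_seq.
apply: eq_bigr => x; rewrite mem_minorants => x_le.
rewrite big_seq [RHS]big_seq.
apply: eq_bigr => y; rewrite mem_minorants => y_le.
by rewrite !mcoeff_Hbasis x_le y_le mulr1 scale1r.
Qed.

Definition minorants_fixing n (p : clique M n) (x y : nat) : seq (clique M n) :=
  [seq p' <- minorants p | label p' x y == label p x y].

Lemma mem_minorants_fixing n (p p' : clique M n) x y :
  (p' \in minorants_fixing p x y) =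
  (label p' x y == label p x y) && le_be p' p.
Proof. by rewrite mem_filter mem_minorants. Qed.

Lemma minorants_fixing_uniq n (p : clique M n) x y :
  uniq (minorants_fixing p x y).
Proof. by rewrite filter_uniq ?fset_uniq. Qed.

Lemma le_be_erase n (p p' : clique M n) u v : (u < v <= n)%N ->
  boundary n u v ->
  le_be p' (erase p u v) = (label p' u v == 1%g) && le_be p' p.
Proof.
move=> uv buv; apply/le_beP/andP => [le_p|[/eqP p'1 /le_beP le_p] x y xy].
  have p'1 : label p' u v = 1%g.
    by have := le_p _ _ uv; rewrite label_erase // !eqxx => -[|[]].
  split; first exact/eqP; apply/le_beP => x y xy.
  have := le_p _ _ xy; rewrite label_erase //.
  by case: andP => // -[/eqP-> /eqP->]; right.
by rewrite label_erase //; case: andP => [[/eqP-> /eqP->]|_];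
  [left | exact: le_p].
Qed.

(** A minorant of [p] differing from [p] on a boundary arc has the label 1 there.
    If [p] has another label on this arc, these are exactly the minorants of
    [p] with the arc erased; otherwise, there are none. *)
Lemma sum_minorants_split (V : nmodType) n (p : clique M n) x y
    (F : clique M n -> V) : (x < y <= n)%N -> boundary n x y ->
  \sum_(p' <- minorants p) F p' =
  \sum_(p' <- minorants_fixing p x y) F p' +
  (if label p x y != 1%g
   then \sum_(p' <- minorants_fixing (erase p x y) x y) F p' else 0).
Proof.
move=> xy bxy.
rewrite (bigID (fun p' => label p' x y == label p x y)) /= -big_filter.
congr (_ + _); rewrite -big_filter; case: eqP => [p1|/eqP p1] /=.
  rewrite big_seq big1 // => p'; rewrite mem_filter mem_minorants p1.
  case/andP => /eqP p'1 /le_beP/(_ _ _ xy) [p'p|[_ //]].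
  by rewrite p'p p1 in p'1.
apply/perm_big/uniq_perm.
- by rewrite filter_uniq ?fset_uniq.
- exact: minorants_fixing_uniq.
move=> p'; rewrite mem_minorants_fixing mem_filter mem_minorants.
rewrite le_be_erase // label_erase // !eqxx /= andbA andbb.
have [/le_beP le_p|] := boolP (le_be p' p); last by rewrite !andbF.
rewrite !andbT; have [->|[_ ->]] := le_p _ _ xy.
  by rewrite eqxx (negPf p1).
by rewrite eqxx eq_sym.
Qed.

(** Composition is a bijection from the pairs of minorants with prescribed
    labels on the glued arcs to the minorants of the composite; the inverse
    is the pair of restrictions to the two sub-polygons. *)
Lemma sum_comp_minorants_fixing n m (p : clique M n.+1) (i : 'I_n.+1)
    (q : clique M m.+1) : (0 < n)%N -> (0 < m)%N ->
  \sum_(p' <- minorants_fixing p i i.+1)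
    \sum_(q' <- minorants_fixing q 0 m.+1) << comp_clique p' i q' >> =
  Hbasis K (comp_clique p i q).
Proof.
move=> n_gt0 m_gt0; rewrite HbasisE.
rewrite -(big_allpairs_dep (h := fun p' q' => comp_clique p' i q')
            (F := fun r => << r >> : CM K M (n + m).+1)).
apply/perm_big/uniq_perm; rewrite ?fset_uniq //.
  apply: allpairs_uniq; rewrite ?minorants_fixing_uniq //.
  move=> _ _ /allpairsP[[p1 q1] /= [p1_in q1_in ->]]
             /allpairsP[[p2 q2] /= [p2_in q2_in ->]] /= eq_comp.
  move: p1_in q1_in p2_in q2_in; rewrite !mem_minorants_fixing.
  move=> /andP[/eqP p1i _] /andP[/eqP q1i _].
  move=> /andP[/eqP p2i _] /andP[/eqP q2i _].
  congr (_, _).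
    rewrite -[LHS](outer_part_comp i n_gt0 m_gt0 p1 q1) eq_comp.
    by rewrite /edge_label p1i -p2i outer_part_comp.
  rewrite -[LHS](inner_part_comp i n_gt0 m_gt0 p1 q1) eq_comp.
  by rewrite /base_label q1i -q2i inner_part_comp.
move=> r; rewrite mem_minorants; apply/allpairsP/idP => [[[p' q'] /= []]|le_r].
  rewrite !mem_minorants_fixing => /andP[/eqP p'i le_p] /andP[/eqP q'0 le_q] ->.
  exact: le_be_comp.
exists (outer_part i (edge_label p i) r, inner_part i (base_label q) r) => /=.
rewrite !mem_minorants_fixing.
rewrite -[label (outer_part _ _ _) _ _]/(edge_label _ i).
rewrite -[label (inner_part _ _ _) _ _]/(base_label _).
rewrite edge_label_outer_part // base_label_inner_part // !eqxx /=.
rewrite (le_be_outer_part n_gt0 m_gt0 le_r).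
by rewrite (le_be_inner_part n_gt0 m_gt0 le_r) comp_outer_inner_part.
Qed.

End Sums.

Theorem proposition2p2p8 (K : fieldType) (charK : [pchar K] =i pred0)
    (M : umagmaType) (n m : nat) (p : clique M n.+1) (q : clique M m.+1)
    (hp : Tagged (clique M) p <> Tagged (clique M) (unit_clique M))
    (hq : Tagged (clique M) q <> Tagged (clique M) (unit_clique M))
    (i : 'I_n.+1) :
  partial_comp (Hbasis K p) i (Hbasis K q) =
  if (edge_label p i != 1%g) && (base_label q != 1%g) then
    Hbasis K (comp_clique p i q) + Hbasis K (comp_clique (d_edge p i) i q)
    + Hbasis K (comp_clique p i (d_base q))
    + Hbasis K (comp_clique (d_edge p i) i (d_base q))
  else if (edge_label p i != 1%g) && (base_label q == 1%g) then
    Hbasis K (comp_clique p i q) + Hbasis K (comp_clique (d_edge p i) i q)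
  else if (edge_label p i == 1%g) && (base_label q != 1%g) then
    Hbasis K (comp_clique p i q) + Hbasis K (comp_clique p i (d_base q))
  else Hbasis K (comp_clique p i q).
Proof.
have n_gt0 := clique_arity_gt1 hp; have m_gt0 := clique_arity_gt1 hq.
have edge_bounds : (i < i.+1 <= n.+1)%N by rewrite ltnSn ltn_ord.
have edge_boundary : boundary n.+1 i i.+1.
  by rewrite /boundary eqxx andbT ltnS n_gt0.
have base_boundary : boundary m.+1 0 m.+1 by rewrite /boundary !eqxx orbT.
have base_bounds : (0 < m.+1 <= m.+1)%N by rewrite /= leqnn.
rewrite partial_comp_Hbasis.
under eq_bigr => p' _ do
  rewrite (sum_minorants_split _ _ base_bounds base_boundary).
rewrite big_split /= !(sum_minorants_split _ _ edge_bounds edge_boundary).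
rewrite -/(edge_label p i) -/(base_label q) -/(d_edge p i) -/(d_base q).
pose sumE p' q' := @sum_comp_minorants_fixing K M n m p' i q' n_gt0 m_gt0.
rewrite (sumE p q).
(* What remains is bookkeeping of zeros and parentheses, valid for an arbitrary
   function in place of Hbasis. *)
case: eqP => _; case: eqP => _ /=.
- by rewrite big1_eq !addr0.
- by rewrite (sumE p (d_base q)); move: (@Hbasis K M) => H; rewrite !addr0.
- rewrite (sumE (d_edge p i) q) !big1_eq.
  by move: (@Hbasis K M) => H; rewrite !addr0.
- rewrite (sumE (d_edge p i) q) (sumE p (d_base q)).
  rewrite (sumE (d_edge p i) (d_base q)).
  by move: (@Hbasis K M) => H; rewrite addrA.
Qed.
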